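(* Let $n>2$ be an integer and $r\ge1$ an integer with $2^r+1<2^n$, and let $s_i=(2^r+1)2^{n+i}+1$ for $i\in\mathbb{N}$. Then the Frobenius number of $P_{2^r+1}(n)$ is $\mathrm{F}(P_{2^r+1}(n))=2s_1+s_n+s_{n+r}-s_0$.
   Context: $P_{2^r+1}(n)$ is the numerical semigroup consisting of all finite non-negative integer linear combinations of $\{(2^r+1)2^{n+i}+1\mid i\in\mathbb{N}\}$. The Frobenius number $\mathrm{F}(S)$ of a numerical semigroup $S$ is the largest integer not in $S$. *)

(* Defs.v *)
From HB Require Import structures.
From mathcomp Require Import all_boot all_order all_algebra.

Set Implicit Arguments.
Unset Strict Implicit.
Unset Printing Implicit Defensive.

Import Order.TTheory GRing.Theory Num.Theory.

Definition nat_span (A : nat -> Prop) (m : nat) : Prop :=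
  exists (k : nat) (c x : 'I_k -> nat),
    (forall i, A (x i)) /\ m = \sum_(i < k) c i * x i.

Definition s (r n i : nat) : nat := (2 ^ r + 1) * 2 ^ (n + i) + 1.

(* P r n is the semigroup P_{2^r+1}(n). *)
Definition P (r n : nat) : nat -> Prop :=
  nat_span (fun x => exists i : nat, x = s r n i).

Definition in_int (S : nat -> Prop) (z : int) : Prop :=
  exists2 m : nat, S m & z = m%:Z%R.

(* The Frobenius number is the largest *integer* not in S (so it is -1 when S
   is all of nat); it is rendered as a relation because a general S need not
   have one. *)
Definition is_Frobenius (S : nat -> Prop) (f : int) : Prop :=
  ~ in_int S f /\ (forall z : int, ~ in_int S z -> (z <= f)%R).

Lemma is_Frobenius_uniq (S : nat -> Prop) (f g : int) :
  is_Frobenius S f -> is_Frobenius S g -> f = g.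
Proof.
move=> [nf lef] [ng leg]; apply/eqP.
by rewrite eq_le (leg _ nf) (lef _ ng).
Qed.

(* Main.v *)
(** Put [M = 2 ^ n + 2 ^ (n + r)], so that [s_i = M * 2 ^ i + 1].  Then [y]
    belongs to the semigroup iff [y = M * T + N], where [T] is a sum of exactly
    [N] powers of two; equivalently [y = M * T + N] with [T - N] a sum of [N]
    numbers of the form [2 ^ i - 1].  The claimed Frobenius number is
    [M * (M + 3) + 3].

    It is not in the semigroup: as [N <= T], the only candidate is [T = M + 3],
    [N = 3], and [M + 3] has four binary digits equal to 1.

    Everything larger is: write [y = M * q + (q - x)] with [x <= M].  Since
    [2 ^ m - 1 - e] is a sum of [e + 1] numbers [2 ^ i - 1], the number
    [x = M - d] is a sum of at most [d + 3] of them if [d >= 1], and of 4 of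
    them if [d = 0]; when [y] exceeds the bound, [q - x] is at least that. *)
Require Import Defs.
From mathcomp Require Import all_boot all_order all_algebra.
From mathcomp Require Import zify.

Definition mersenne_sum (N x : nat) : Prop :=
  exists2 l : seq nat, size l = N & x = \sum_(i <- l) (2 ^ i - 1).

(* Padding uses [2 ^ 0 - 1 = 0]. *)
Lemma mersenne_sum_leq (N N' x : nat) :
  N <= N' -> mersenne_sum N x -> mersenne_sum N' x.
Proof.
move=> leN [l sl ->]; exists (l ++ nseq (N' - N) 0).
  by rewrite size_cat size_nseq sl subnKC.
by rewrite big_cat /= [X in _ + X]big_nseq subnn iter_addn_0 mul0n addn0.
Qed.

Lemma mersenne_sum_cons (N i x : nat) :
  mersenne_sum N x -> mersenne_sum N.+1 (2 ^ i - 1 + x).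
Proof. by move=> [l sl ->]; exists (i :: l); rewrite ?big_cons //= sl. Qed.

(** Induction on the exponent: for a positive deficit, either a summand [2 ^ m - 1] splits off and
    the deficit drops by one, or the target is below [2 ^ m - 1] and the deficit drops by
    [2 ^ m]. *)
Lemma mersenne_sum_sub (m e : nat) :
  e < 2 ^ m -> mersenne_sum e.+1 (2 ^ m - 1 - e).
Proof.
elim: m e => [|m IH] [|e] he.
- by exists [:: 0]; rewrite ?big_seq1.
- by move: he; rewrite expn0.
- by exists [:: m.+1]; rewrite ?big_seq1 ?subn0.
move: he; rewrite expnS => he.
have [lem|ltm] := ltnP e (2 ^ m).
  have -> : 2 * 2 ^ m - 1 - e.+1 = 2 ^ m - 1 + (2 ^ m - 1 - e) by lia.
  exact/mersenne_sum_cons/IH.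
have -> : 2 * 2 ^ m - 1 - e.+1 = 2 ^ m - 1 - (e.+1 - 2 ^ m) by lia.
apply: mersenne_sum_leq (IH _ _); have := expn_gt0 2 m; lia.
Qed.

(** Taking [2 ^ a - 1] and [2 ^ b - 1] already loses 2, so [d = 1] needs an extra summand 1; a
    larger [d] leaves its remaining deficit on one power, the other being whole or absent. *)
Lemma mersenne_sum_near (a b d : nat) : 0 < d -> d <= 2 ^ a + 2 ^ b ->
  mersenne_sum (d + 3) (2 ^ a + 2 ^ b - d).
Proof.
move=> d0 led; have a0 := expn_gt0 2 a; have b0 := expn_gt0 2 b.
have [->|d1] := eqVneq d 1.
  have -> : 2 ^ a + 2 ^ b - 1 = 2 ^ a - 1 + (2 ^ b - 1 + (2 ^ 1 - 1 + 0)) by lia.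
  do 3![apply: mersenne_sum_cons].
  by exists [:: 0]; rewrite ?big_seq1.
have [lea|lta] := leqP d (2 ^ a + 1).
  have -> : 2 ^ a + 2 ^ b - d = 2 ^ b - 1 + (2 ^ a - 1 - (d - 2)) by lia.
  apply: (@mersenne_sum_leq (d - 2).+2); first lia.
  apply/mersenne_sum_cons/mersenne_sum_sub; lia.
have -> : 2 ^ a + 2 ^ b - d = 2 ^ b - 1 - (d - 2 ^ a - 1) by lia.
apply: mersenne_sum_leq (mersenne_sum_sub _ _ _); lia.
Qed.

Lemma mersenne_sum_two_pow (a b : nat) : mersenne_sum 4 (2 ^ a + 2 ^ b).
Proof.
exists [:: a; b; 1; 1] => //; rewrite !big_cons big_nil.
have := expn_gt0 2 a; have := expn_gt0 2 b; lia.
Qed.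

(** The sum lies strictly between [2 ^ c] and [2 ^ c.+1]. *)
Lemma pow2_neq_sum_pow2 (a b c : nat) : b < c -> 2 ^ a <> 2 ^ c + 2 ^ b.
Proof.
move=> bc E; have b0 := expn_gt0 2 b.
have ltbc : 2 ^ b < 2 ^ c by rewrite ltn_exp2l.
have : c < a by rewrite -(@ltn_exp2l 2) // E; lia.
by rewrite -(@leq_exp2l 2) // expnS E; lia.
Qed.

(** Parity, twice: one or all three powers are 1. Three ones are too small; removing a single one
    and halving leaves an odd total again, so one power would be a sum of two distinct ones. *)
Lemma sum_three_pow2_neq (n r a b c : nat) : 1 < n -> 0 < r ->
  2 ^ a + 2 ^ b + 2 ^ c <> 2 ^ n + 2 ^ (n + r) + 3.
Proof.
case: n => [|[|n]] // _ r0 E.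
have two (x y : nat) : 2 ^ x + 2 ^ y <> 2 * 2 ^ n + 2 * 2 ^ (n + r) + 1.
  case: x y => [|x] [|y]; rewrite ?expnS ?expn0 => H.
  - have := expn_gt0 2 n; lia.
  - apply: (@pow2_neq_sum_pow2 y.+1 n.+1 (n + r).+1); first lia.
    by rewrite !expnS; lia.
  - apply: (@pow2_neq_sum_pow2 x.+1 n.+1 (n + r).+1); first lia.
    by rewrite !expnS; lia.
  - lia.
have := expn_gt0 2 n.
case: a b c E => [|a] [|b] [|c]; rewrite !addSn ?expnS ?expn0 => E n0.
- lia.
- lia.
- lia.
- apply: (two b c); lia.
- lia.
- apply: (two a c); lia.
- apply: (two a b); lia.
- lia.
Qed.

Lemma P_sum (r n y : nat) :
  P r n y <-> exists l : seq nat, y = \sum_(i <- l) s r n i.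
Proof.
split=> [[k [c [x [Ax ->]]]]|[l ->]].
  elim/big_rec: _ => [|i _ _ [l ->]]; first by exists [::]; rewrite big_nil.
  have [j ->] := Ax i; exists (nseq (c i) j ++ l).
  by rewrite big_cat /= big_nseq iter_addn_0 mulnC.
exists (size l), (fun=> 1), (fun i => s r n (nth 0 l i)); split.
  by move=> i; exists (nth 0 l i).
by rewrite (big_nth 0) big_mkord; apply: eq_bigr => i _; rewrite mul1n.
Qed.

Lemma sE (r n i : nat) : s r n i = (2 ^ n + 2 ^ (n + r)) * 2 ^ i + 1.
Proof. by rewrite /s !expnD; lia. Qed.

Lemma sum_s (r n : nat) (l : seq nat) :
  \sum_(i <- l) s r n i =
    (2 ^ n + 2 ^ (n + r)) * \sum_(i <- l) 2 ^ i + size l.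
Proof.
elim: l => [|i l IH]; first by rewrite !big_nil muln0.
by rewrite !big_cons IH sE mulnDr /=; lia.
Qed.

Lemma sum_pow2E (l : seq nat) :
  \sum_(i <- l) 2 ^ i = \sum_(i <- l) (2 ^ i - 1) + size l.
Proof.
elim: l => [|i l IH]; first by rewrite !big_nil.
by rewrite !big_cons IH /=; have := expn_gt0 2 i; lia.
Qed.

Lemma P_mersenne (r n y : nat) :
  P r n y <->
  exists N x : nat, mersenne_sum N x /\
    y = (2 ^ n + 2 ^ (n + r)) * (x + N) + N.
Proof.
split=> [/P_sum[l ->]|[N [x [[l sl ->] ->]]]].
  exists (size l), (\sum_(i <- l) (2 ^ i - 1)); split; first by exists l.
  by rewrite sum_s sum_pow2E.
by apply/P_sum; exists l; rewrite sum_s sum_pow2E sl.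
Qed.

Lemma Frobenius_notin_P (n r : nat) : 1 < n -> 0 < r ->
  let M := 2 ^ n + 2 ^ (n + r) in ~ P r n (M * (M + 3) + 3).
Proof.
move=> n1 r0 M /P_mersenne[N [x [[l sl xE] E]]].
rewrite -/M in E.
have M4 : 4 <= M.
  by apply: leq_trans (leq_addr _ _); rewrite -[4]/(2 ^ 2) leq_exp2l.
have leT : x + N <= M + 3.
  by rewrite leqNgt; apply/negP => /(leq_mul (leqnn M)); lia.
(* As [N <= x + N], a smaller [x + N] gives at most [(M + 1) * (M + 2)], one short of the target. *)
have geT : M + 3 <= x + N.
  by rewrite leqNgt; apply/negP => ltT; have := leq_mul (leqnn M) ltT; lia.
have TE : x + N = M + 3 by lia.
have N3 : N = 3 by move: E; rewrite TE => /addnI.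
have xM : x = M by lia.
have sumE : \sum_(i <- l) 2 ^ i = M + 3 by rewrite sum_pow2E -xE sl xM N3.
move: sl sumE; rewrite N3; case: l {xE} => [|a [|b [|c [|]]]] // _.
by rewrite !big_cons big_nil addn0 addnA; apply: sum_three_pow2_neq.
Qed.

Lemma gt_Frobenius_in_P (n r y : nat) :
  let M := 2 ^ n + 2 ^ (n + r) in M * (M + 3) + 3 < y -> P r n y.
Proof.
move=> M lty.
have [q [x [lex yE]]] : exists q x, x <= M /\ y + x = q * M.+1.
  (* Here [q] is [y / (M + 1)] rounded up. *)
  exists ((y + M) %/ M.+1), (M - (y + M) %% M.+1); split; first exact: leq_subr.
  have := divn_eq (y + M) M.+1; have := ltn_pmod (y + M) (ltn0Sn M); lia.
have geq : M + 3 <= q.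
  by rewrite leqNgt; apply/negP => ltq; have : q * M.+1 <= (M + 2) * M.+1;
    [apply: leq_mul; lia | lia].
apply/P_mersenne; exists (q - x), x; split; last first.
  by rewrite -/M subnKC; lia.
(* For [x = M] four summands are needed, hence [q >= M + 4]: with [q = M + 3], [y] would be the
   Frobenius number itself. *)
have [xM|neM] := eqVneq x M.
  rewrite xM; apply: mersenne_sum_leq (mersenne_sum_two_pow _ _).
  rewrite leqNgt; apply/negP => ltq; have : q * M.+1 <= (M + 3) * M.+1;
    [by apply: leq_mul; lia | lia].
have -> : x = M - (M - x) by rewrite subKn.
apply: mersenne_sum_leq (mersenne_sum_near _ _ _ _ _); rewrite -/M; lia.
Qed.

Theorem theorem6 (n r : nat) (hn : 2 < n) (hr : 1 <= r)
    (hrn : 2 ^ r + 1 < 2 ^ n) :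
  is_Frobenius (P r n)
    (2 * (s r n 1)%:Z + (s r n n)%:Z + (s r n (n + r))%:Z - (s r n 0)%:Z)%R.
Proof.
set M := 2 ^ n + 2 ^ (n + r).
have -> : (2 * (s r n 1)%:Z + (s r n n)%:Z + (s r n (n + r))%:Z
    - (s r n 0)%:Z)%R = (M * (M + 3) + 3)%:Z%R.
  rewrite !sE -/M expn0 expn1.
  (* The square comes from [s r n n] and [s r n (n + r)] together. *)
  have : M * M = M * 2 ^ n + M * 2 ^ (n + r) by rewrite -mulnDr.
  lia.
split=> [[m Pm [mE]]|z nz].
  apply: (@Frobenius_notin_P n r) => //; first exact: ltnW.
  by rewrite -/M mE.
rewrite Order.TotalTheory.leNgt; apply/negP => ltz; apply: nz.
case: z ltz => [m|m]; last by lia.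
by rewrite ltz_nat => ltm; exists m => //; apply: gt_Frobenius_in_P.
Qed.
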